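(* For $\rho\in[1/2,1)$ let $Y_\rho$ be the space $\mathbb{R}^2$ equipped with the norm $$\|x\|_\rho=\max\left\{\left|x_1+\left(2-\tfrac1\rho\right)x_2\right|,\ \left|x_2+\left(2-\tfrac1\rho\right)x_1\right|,\ |x_1-x_2|\right\},\qquad x=(x_1,x_2).$$ Then for every $\varepsilon\in(0,\frac12)$, as $\rho\to1$ (with $\rho<1$), $\Phi(\ell_1^{(2)},Y_\rho,\varepsilon)$ does not converge to $\Phi(\ell_1^{(2)},\ell_1^{(2)},\varepsilon)$, and $\Phi^S(\ell_1^{(2)},Y_\rho,\varepsilon)$ does not converge to $\Phi^S(\ell_1^{(2)},\ell_1^{(2)},\varepsilon)$.
   Context: All Banach spaces are real. $\ell_1^{(2)}$ is $\mathbb{R}^2$ with the norm $|x_1|+|x_2|$. $B_X$, $S_X$ denote the closed unit ball and unit sphere of $X$; $L(X,Y)$ is the space of bounded linear operators $X\to Y$ with the operator norm. Bishop-Phelps-Bollobás modulus: for $\varepsilon\in(0,1)$, $\Phi(X,Y,\varepsilon)$ is the infimum of those $\delta>0$ such that for every $(x,T)\in B_X\times B_{L(X,Y)}$ with $\|T(x)\|>1-\varepsilon$ there is $(z,F)\in S_X\times S_{L(X,Y)}$ with $\|F(z)\|=1$, $\|x-z\|<\delta$ and $\|T-F\|<\delta$. The spherical modulus $\Phi^S(X,Y,\varepsilon)$ is defined in the same way with $(x,T)\in S_X\times S_{L(X,Y)}$ in place of $(x,T)\in B_X\times B_{L(X,Y)}$. *)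

(* Defs.v *)
From HB Require Import structures.
From mathcomp Require Import all_boot all_order all_algebra.
From mathcomp Require Import all_classical all_reals all_analysis.
From mathcomp Require Import ring lra.

Set Implicit Arguments.
Unset Strict Implicit.
Unset Printing Implicit Defensive.

Import Order.TTheory GRing.Theory Num.Theory.
Import numFieldNormedType.Exports.

Local Open Scope classical_set_scope.
Local Open Scope ring_scope.

Section Modulus.
Context {R : realType}.

Definition unit_ball (X : normedModType R) : set X := [set x | `|x| <= 1].
Definition unit_sphere (X : normedModType R) : set X := [set x | `|x| = 1].

(* The real supremum [sup] is only meaningful on bounded operators; it is
   used below only under the boundedness condition [bounded_fun_norm]. *)
Definition op_norm (X Y : normedModType R) (T : X -> Y) : R :=
  sup [set `|T x| | x in @unit_ball X].

Definition op_unit_ball (X Y : normedModType R) : set {linear X -> Y} :=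
  [set T | bounded_fun_norm T /\ op_norm T <= 1].
Definition op_unit_sphere (X Y : normedModType R) : set {linear X -> Y} :=
  [set T | bounded_fun_norm T /\ op_norm T = 1].

Definition BPB_set (X Y : normedModType R) (A : set X)
    (B : set {linear X -> Y}) (eps : R) : set R :=
  [set delta | 0 < delta /\
    forall (x : X) (T : {linear X -> Y}), A x -> B T -> 1 - eps < `|T x| ->
    exists (z : X) (F : {linear X -> Y}),
      [/\ unit_sphere z, op_unit_sphere F, `|F z| = 1,
          `|x - z| < delta & op_norm (T \- F) < delta]].

(* For 0 < eps < 1 these sets contain every delta > 2, so the real
   infimum is the genuine one. *)
Definition Phi (X Y : normedModType R) (eps : R) : R :=
  inf (BPB_set (@unit_ball X) (@op_unit_ball X Y) eps).
Definition PhiS (X Y : normedModType R) (eps : R) : R :=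
  inf (BPB_set (@unit_sphere X) (@op_unit_sphere X Y) eps).

End Modulus.

(* The library norm on [R * R] is the max norm, hence the type aliases. *)
Definition ell1_2 (R : realType) : Type := (R * R)%type.

HB.instance Definition _ (R : realType) :=
  GRing.Lmodule.copy (ell1_2 R) (R * R)%type.

Section Ell1.
Context {R : realType}.

Definition ell1_2_norm (x : ell1_2 R) : R := `|x.1| + `|x.2|.

Lemma ell1_2_normD (x y : ell1_2 R) :
  ell1_2_norm (x + y) <= ell1_2_norm x + ell1_2_norm y.
Proof. by rewrite /ell1_2_norm addrACA lerD// ler_normD. Qed.

Lemma ell1_2_normZ (a : R) (x : ell1_2 R) :
  ell1_2_norm (a *: x) = `|a| * ell1_2_norm x.
Proof. by rewrite /ell1_2_norm mulrDr -!normrM. Qed.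

Lemma ell1_2_norm0_eq0 (x : ell1_2 R) : ell1_2_norm x = 0 -> x = 0.
Proof.
case: x => a b /eqP; rewrite /ell1_2_norm/= paddr_eq0//.
by rewrite !normr_eq0 => /andP[/eqP-> /eqP->].
Qed.

HB.instance Definition _ := Lmodule_isNormed.Build R (ell1_2 R)
  ell1_2_normD ell1_2_normZ ell1_2_norm0_eq0.

End Ell1.

Definition rho_range (R : realType) : Type :=
  {rho : R | 2^-1 <= rho < 1}.

Definition Yspace (R : realType) (rho : rho_range R) : Type := (R * R)%type.

HB.instance Definition _ (R : realType) (rho : rho_range R) :=
  GRing.Lmodule.copy (Yspace rho) (R * R)%type.

Section Yrho.
Context {R : realType} (rho : rho_range R).

Definition Y_norm (x : Yspace rho) : R :=
  let c := 2 - 1 / val rho in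
  Num.max (Num.max `|x.1 + c * x.2| `|x.2 + c * x.1|) `|x.1 - x.2|.

Lemma Y_normD (x y : Yspace rho) : Y_norm (x + y) <= Y_norm x + Y_norm y.
Proof.
rewrite /Y_norm/=; set c := (2 - _).
have tri (v w a b : R) : `|v| <= a -> `|w| <= b -> `|v + w| <= a + b.
  by move=> va wb; rewrite (le_trans (ler_normD _ _))// lerD.
rewrite !ge_max -!andbA; apply/and3P; split.
- rewrite mulrDr addrACA; apply: tri; rewrite !le_max lexx//.
- rewrite mulrDr addrACA; apply: tri; rewrite !le_max lexx ?orbT//.
- rewrite opprD addrACA; apply: tri; rewrite !le_max lexx ?orbT//.
Qed.

Lemma Y_normZ (a : R) (x : Yspace rho) : Y_norm (a *: x) = `|a| * Y_norm x.
Proof.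
rewrite /Y_norm/=; set c := (2 - _).
by rewrite !maxr_pMr// -!normrM !mulrDr mulrN !(mulrCA a).
Qed.

Lemma Y_norm0_eq0 (x : Yspace rho) : Y_norm x = 0 -> x = 0.
Proof.
case: x => a b; rewrite /Y_norm/=; set c := (2 - _) => N0.
have c0 : 0 <= c.
  have /andP[r2 _] := valP rho.
  have r0 : 0 < val rho by rewrite (lt_le_trans _ r2)// invr_gt0.
  by rewrite subr_ge0 div1r -[leRHS]invrK lef_pV2// posrE invr_gt0.
have /eqP ab : a - b == 0.
  by rewrite -normr_le0 -N0 le_max lexx orbT.
have : a + c * b == 0.
  by rewrite -normr_le0 -N0 !le_max lexx.
move: ab => /subr0_eq ->.
rewrite -[X in X + _]mul1r -mulrDl mulf_eq0 => /orP[/eqP c1|/eqP->//].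
by exfalso; move: c1 c0; clearbody c; lra.
Qed.

HB.instance Definition _ := Lmodule_isNormed.Build R (Yspace rho)
  Y_normD Y_normZ Y_norm0_eq0.

End Yrho.

(* The trace on the parameter range of the filter of left neighborhoods of 1. *)
Definition rho_to_1 (R : realType) : set_system (rho_range R) :=
  filter_from (at_left (1 : R)) (fun U => [set rho | U (val rho)]).
Arguments rho_to_1 : clear implicits.

#[global] Instance rho_to_1_proper (R : realType) :
  ProperFilter (rho_to_1 R).
Proof.
apply: filter_from_proper; first apply: filter_from_filter.
- by exists setT; exact: filterT.
- by move=> U V HU HV; exists (U `&` V) => //; exact: filterI.
- move=> U HU.
  have h : \forall r \near at_left (1 : R), 2^-1 <= r < 1 /\ U r.
    near=> r; split; last by near: r.
    apply/andP; split; last by near: r; exact: nbhs_left_lt.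
    near: r; apply: nbhs_left_ge; lra.
  have [r [hr Ur]] := @filter_ex _ _ _ _ h.
  by exists (exist _ r hr).
Unshelve. all: by end_near. Qed.

(* Main.v *)
(* Write c = 2 - 1/rho < 1. The unit ball of Y_rho is a hexagon in which the
   edge [e1, e2] of the unit ball of l_1 is broken at the vertex
   (1, 1) / (1 + c). Take x = (1/2, 1/2) and T = (e1 |-> e1, e2 |-> e2), so
   that |T x| >= (1 + c) / 2 > 1 - eps for rho near 1. If |x - z| < 1, both
   coordinates of z are positive, and an operator F attaining its norm at z
   must send e1 and e2 to a common face; no face has points at distance less
   than 1 from e1 and from e2 respectively, so |T - F| >= 1. Hence both moduli
   of Y_rho are at least 1 for rho near 1.
   For l_1 as target, the norm is the maximum of the two functionals
   |y1 + y2| and |y1 - y2|, which can be modified independently; the problem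
   reduces to the Bishop-Phelps-Bollobas theorem for functionals on l_1, and
   every d <= 1 with d^2 >= 2 eps is admissible. For eps < 1/2 some d < 1 is. *)
Require Import Defs.
From mathcomp Require Import all_boot all_order all_algebra.
From mathcomp Require Import all_classical all_reals all_analysis.
From HB Require Import structures.
From mathcomp Require Import ring lra.

Import Order.TTheory GRing.Theory Num.Theory.
Import numFieldNormedType.Exports.

Local Open Scope classical_set_scope.
Local Open Scope ring_scope.

(** * Operators from l_1 into a normed space *)

Section Ell1Operators.
Context {R : realType} {Y : normedModType R}.
Implicit Types (T : {linear ell1_2 R -> Y}) (u v : Y).

Definition e1 : ell1_2 R := (1, 0).
Definition e2 : ell1_2 R := (0, 1).

Lemma norm_e1 : `|e1| = 1.
Proof. by change (`|1 : R| + `|0 : R| = 1); rewrite normr1 normr0 addr0. Qed.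

Lemma norm_e2 : `|e2| = 1.
Proof. by change (`|0 : R| + `|1 : R| = 1); rewrite normr1 normr0 add0r. Qed.

Definition ell1_op u v (x : ell1_2 R) : Y := x.1 *: u + x.2 *: v.

Lemma ell1_op_linear u v : linear (ell1_op u v).
Proof.
move=> a x y; rewrite /ell1_op/= !scalerDl scalerDr !scalerA.
by rewrite addrACA.
Qed.

HB.instance Definition _ u v := GRing.isLinear.Build R (ell1_2 R) Y *:%R
  (ell1_op u v) (ell1_op_linear u v).

Lemma ell1_op_e1 u v : ell1_op u v e1 = u.
Proof. by rewrite /ell1_op scale1r scale0r addr0. Qed.

Lemma ell1_op_e2 u v : ell1_op u v e2 = v.
Proof. by rewrite /ell1_op scale1r scale0r add0r. Qed.

Lemma ell1_linearE T x : T x = x.1 *: T e1 + x.2 *: T e2.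
Proof.
rewrite -!linearZ -linearD; congr (T _); case: x => a b.
by apply: injective_projections => /=; rewrite /GRing.scale/= ?mulr0 ?mulr1
  ?addr0 ?add0r.
Qed.

Lemma ell1_op_le T x : `|T x| <= Num.max `|T e1| `|T e2| * `|x|.
Proof.
rewrite ell1_linearE (le_trans (ler_normD _ _))// !normrZ.
rewrite [X in _ <= _ * X](_ : _ = `|x.1| + `|x.2|)// mulrDr lerD//.
  by rewrite mulrC ler_wpM2r// le_max lexx.
by rewrite mulrC ler_wpM2r// le_max lexx orbT.
Qed.

Lemma ell1_bounded T : bounded_fun_norm T.
Proof.
move=> r; exists (Num.max `|T e1| `|T e2| * r) => x xr.
by rewrite (le_trans (ell1_op_le _ _))// ler_wpM2l// le_max normr_ge0.
Qed.

(** The unit ball of l_1 is the convex hull of the points [e1], [e2] and their opposites, so a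
    convex function such as the norm of [T x] is largest at one of them. *)
Lemma ell1_op_norm T : op_norm T = Num.max `|T e1| `|T e2|.
Proof.
have ub : ubound [set `|T x| | x in @unit_ball _ (ell1_2 R)]
    (Num.max `|T e1| `|T e2|).
  move=> _ [x /= x1 <-]; rewrite (le_trans (ell1_op_le _ _))//.
  by rewrite ler_piMr// le_max normr_ge0.
apply/eqP; rewrite eq_le; apply/andP; split.
  by apply: ge_sup => //; exists `|T e1|, e1 => //;
    rewrite /unit_ball/= norm_e1.
rewrite ge_max; apply/andP; split;
  (apply: ub_le_sup; first by eexists; exact: ub).
- by exists e1 => //; rewrite /unit_ball/= norm_e1.
- by exists e2 => //; rewrite /unit_ball/= norm_e2.
Qed.

(** Both distances are at most 2 by the triangle inequality. The resulting nonemptiness is what a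
    lower bound on the infimum requires. *)
Lemma BPB_set_bounded (A : set (ell1_2 R)) (B : set {linear ell1_2 R -> Y})
    (eps : R) (w : Y) :
  A `<=` @unit_ball _ _ -> B `<=` @op_unit_ball _ _ _ -> `|w| = 1 ->
  BPB_set A B eps 3.
Proof.
move=> A1 B1 w1; split; first by lra.
move=> x T /A1 x1 /B1[_]; rewrite ell1_op_norm ge_max => /andP[T1 T2] _.
exists e1, (ell1_op w 0); split.
- exact: norm_e1.
- split; first exact: ell1_bounded.
  rewrite ell1_op_norm/= ell1_op_e1 ell1_op_e2 w1 normr0.
  by apply/max_idPl; lra.
- by rewrite /= ell1_op_e1.
- apply: (le_lt_trans (ler_normB _ _)); rewrite norm_e1.
  by move: x1; rewrite /unit_ball/=; lra.
- rewrite ell1_op_norm/= ell1_op_e1 ell1_op_e2 subr0 gt_max.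
  apply/andP; split; last by lra.
  by apply: (le_lt_trans (ler_normB _ _)); lra.
Qed.

End Ell1Operators.

(** * Lower bound for the target Y_rho *)

Lemma convex_combination_eq1 {R : realFieldType} (s t a b : R) :
  0 < s -> 0 < t -> s + t = 1 -> a <= 1 -> b <= 1 -> s * a + t * b = 1 ->
  a = 1 /\ b = 1.
Proof.
move=> s0 t0 st a1 b1 E.
have : s * (1 - a) + t * (1 - b) = 0.
  by rewrite !mulrBr !mulr1; lra.
have sa : 0 <= s * (1 - a) by rewrite mulr_ge0 ?subr_ge0 ?(ltW s0).
have tb : 0 <= t * (1 - b) by rewrite mulr_ge0 ?subr_ge0 ?(ltW t0).
move/eqP; rewrite paddr_eq0// !mulf_eq0 (gt_eqF s0) (gt_eqF t0)/= !subr_eq0.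
by case/andP => /eqP -> /eqP ->.
Qed.

(** The endpoints of [-1, 1] are its extreme points. Applied to a functional that norms [F z], this
    puts [F e1] and [F e2] on one face. *)
Lemma convex_combination_norm_eq1 {R : realFieldType} (s t a b : R) :
  0 < s -> 0 < t -> s + t = 1 -> `|a| <= 1 -> `|b| <= 1 ->
  `|s * a + t * b| = 1 -> (a = 1 /\ b = 1) \/ (a = -1 /\ b = -1).
Proof.
rewrite !ler_norml => s0 t0 st /andP[a1 a2] /andP[b1 b2] /eqP.
rewrite eqr_norml ler01 andbT => /orP[/eqP E|/eqP E].
  by left; apply: (convex_combination_eq1 _ _ _ _ s0 t0).
right; have [] := convex_combination_eq1 _ _ (- a) (- b) s0 t0 st; lra.
Qed.

(** If [s <= 0], the distance is at least (1/2 + |s|) + (|t| - 1/2) = 1; likewise for [t]. *)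
Lemma ell1_near_midpoint {R : realFieldType} (s t : R) :
  `|s| + `|t| = 1 -> `|2^-1 - s| + `|2^-1 - t| < 1 ->
  [/\ 0 < s, 0 < t & s + t = 1].
Proof.
by do 4 ![case: ger0P => ?] => *; split; lra.
Qed.

(** Letting [A] and [B] lie anywhere between sphere and ball covers both moduli at once. *)
Lemma Yspace_inf_BPB_set_ge1 {R : realType} (rho : rho_range R) (eps : R)
    (A : set (ell1_2 R)) (B : set {linear ell1_2 R -> Yspace rho}) :
  1 - 2 * eps < 2 - 1 / val rho ->
  @unit_sphere R (ell1_2 R) `<=` A -> A `<=` @unit_ball _ _ ->
  @op_unit_sphere R (ell1_2 R) (Yspace rho) `<=` B ->
  B `<=` @op_unit_ball _ _ _ ->
  1 <= inf (BPB_set A B eps).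
Proof.
move=> ceps SA AB SB BB.
have NE (y : Yspace rho) : `|y| = Num.max
    (Num.max `|y.1 + (2 - 1 / val rho) * y.2| `|y.2 + (2 - 1 / val rho) * y.1|)
    `|y.1 - y.2| by [].
set c := 2 - 1 / val rho in ceps NE.
have [c0 c1] : 0 <= c /\ c < 1.
  have /andP[r2 r1] := valP rho.
  have r0 : 0 < val rho by rewrite (lt_le_trans _ r2)// invr_gt0.
  rewrite /c div1r; split.
    by rewrite subr_ge0 -[leRHS]invrK lef_pV2// posrE invr_gt0.
  have : 1 < (val rho)^-1 by rewrite invf_gt1.
  by lra.
clearbody c.
pose w1 : Yspace rho := (1, 0); pose w2 : Yspace rho := (0, 1).
have nw1 : `|w1| = 1.
  rewrite NE/= !(mulr0, mulr1, addr0, subr0, add0r) normr1 (ger0_norm c0).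
  by rewrite (max_l (ltW c1)) maxxx.
have nw2 : `|w2| = 1.
  rewrite NE/= !(mulr0, mulr1, addr0, subr0, add0r) normr1 (ger0_norm c0).
  by rewrite (max_r (ltW c1)) normrN normr1 maxxx.
apply: lb_le_inf; first by exists 3; exact: (BPB_set_bounded _ _ _ _ AB BB nw1).
move=> d [d0 /(_ (2^-1, 2^-1) (ell1_op w1 w2))].
case.
- apply: SA; rewrite /unit_sphere/=.
  change (`|2^-1 : R| + `|2^-1 : R| = 1); rewrite ger0_norm; lra.
- apply: SB; split; first exact: ell1_bounded.
  by rewrite ell1_op_norm/= ell1_op_e1 ell1_op_e2 nw1 nw2 maxxx.
(* At the midpoint the first functional takes the value (1 + c) / 2, which exceeds [1 - eps] by
   [ceps]. *)
- rewrite NE lt_max; apply/orP; left; rewrite lt_max; apply/orP; left.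
  rewrite /= /GRing.scale/= ger0_norm; lra.
move=> z [F [z1 [_ F1] Fz]].
rewrite ell1_op_norm/= ell1_op_e1 ell1_op_e2.
rewrite /unit_sphere/= in z1.
move: Fz; rewrite ell1_linearE.
have: op_norm F <= 1 by rewrite F1.
rewrite ell1_op_norm.
case: z z1 => s t st1 /=.
rewrite [X in X < d](_ : _ = `|2^-1 - s| + `|2^-1 - t|)//.
move: (F e1) (F e2) => [p q] [a b].
rewrite gt_max ge_max !NE /= /GRing.scale/= !ge_max !gt_max.
move=> /andP[/andP[/andP[u1 u2] u3] /andP[/andP[v1 v2] v3]] Fz.
move=> zd /andP[/andP[/andP[du1 du2] du3] /andP[/andP[dv1 dv2] dv3]].
rewrite leNgt; apply/negP => d1.
have [s0 t0 st] := ell1_near_midpoint s t st1 (lt_trans zd d1).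
have comb := convex_combination_norm_eq1 _ _ _ _ s0 t0 st.
(* Being within 1 of [w1] and [w2], the images [(p, q)] and [(a, b)] keep the signs of the
   functionals that equal 1, or 1 in absolute value, there. *)
have pq : q < p by move: du3; rewrite ltr_norml => /andP[]; lra.
have ab : a < b by move: dv3; rewrite ltr_norml => /andP[]; lra.
have pq1 : 0 < p + c * q by move: du1; rewrite ltr_norml => /andP[]; lra.
have ba1 : 0 < b + c * a by move: dv2; rewrite ltr_norml => /andP[]; lra.
(* Since [c < 1], these say [q + c * p < p + c * q] and [a + c * b < b + c * a]: a common value 1 on
   either broken edge would push one image out of the ball. *)
have cpq : 0 < (1 - c) * (p - q) by rewrite mulr_gt0 ?subr_gt0.
have cab : 0 < (1 - c) * (b - a) by rewrite mulr_gt0 ?subr_gt0.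
move: Fz; rewrite [in X in X -> _]maxEle; case: ifP => _ Fz.
  have [[E1 E2]|[E1 E2]] : (p - q = 1 /\ a - b = 1) \/
      (p - q = -1 /\ a - b = -1).
    by apply: comb => //; rewrite -Fz; congr `|_|; ring.
  - lra.
  - lra.
move: Fz; rewrite [in X in X -> _]maxEle; case: ifP => _ Fz.
  have [[E1 E2]|[E1 E2]] : (q + c * p = 1 /\ b + c * a = 1) \/
      (q + c * p = -1 /\ b + c * a = -1).
    by apply: comb => //; rewrite -Fz; congr `|_|; ring.
  - by move: u1; rewrite ler_norml => /andP[]; lra.
  - lra.
have [[E1 E2]|[E1 E2]] : (p + c * q = 1 /\ a + c * b = 1) \/
    (p + c * q = -1 /\ a + c * b = -1).
  by apply: comb => //; rewrite -Fz; congr `|_|; ring.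
- by move: v2; rewrite ler_norml => /andP[]; lra.
- lra.
Qed.

(** * Upper bound for the target l_1 *)

(* If a coefficient is at least [d] below 1, the corresponding coordinate has
   weight less than [eps / d], so the point moves to the other vertex. *)
Lemma scalar_BPB {R : realFieldType} (eps d p q a b : R) :
  0 < d -> d <= 1 -> 2 * eps <= d ^+ 2 -> 0 <= p -> 0 <= q -> p + q <= 1 ->
  `|a| <= 1 -> `|b| <= 1 -> 1 - eps < a * p + b * q ->
  exists s t a' b', [/\ 0 <= s, 0 <= t, s + t = 1, `|a'| <= 1 & `|b'| <= 1] /\
    [/\ a' * s + b' * t = 1, `|p - s| + `|q - t| < d,
       `|a - a'| < d & `|b - b'| < d].
Proof.
rewrite expr2 !ler_norml => d0 d1 dd p0 q0 pq /andP[a0 a1] /andP[b0 b1] E.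
have pa : 0 <= p * (1 - a) by rewrite mulr_ge0 ?subr_ge0.
have qb : 0 <= q * (1 - b) by rewrite mulr_ge0 ?subr_ge0.
have dd1 : d * d <= d by rewrite ler_piMl // ltW.
have [da|da] := ltP (1 - a) d; have [db|db] := ltP (1 - b) d.
- exists (1 - q), q, 1, 1; rewrite normr1; split; first by split => //; lra.
  rewrite subrr normr0 (distrC a) (distrC b) (distrC p) !ger0_norm; try lra.
  by split; lra.
- exists 1, 0, 1, b; rewrite normr1 ler_norml; split; first by split => //; lra.
  rewrite !subrr normr0 subr0 (distrC a) (distrC p) !ger0_norm; try lra.
  have qd : q * d <= q * (1 - b) by rewrite ler_wpM2l.
  (* The hypothesis on [a * p + b * q] bounds [1 - p - q + q * d] by [eps], so
     [d * (1 - p + q) < 2 * eps <= d * d]; then divide by [d]. *)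
  have H : d * (1 - p + q) <= 2 * (1 - p - q + q * d) by nra.
  split; [lra| |lra|lra].
  by rewrite -(ltr_pM2l d0); lra.
- exists 0, 1, a, 1; rewrite normr1 ler_norml; split; first by split => //; lra.
  rewrite !subrr normr0 subr0 (distrC b) (distrC q) !ger0_norm; try lra.
  have pd : p * d <= p * (1 - a) by rewrite ler_wpM2l.
  have H : d * (p + (1 - q)) <= 2 * (1 - p - q + p * d) by nra.
  split; [lra| |lra|lra].
  by rewrite -(ltr_pM2l d0); lra.
(* Two coefficients far from 1 would give [d < eps], against [2 * eps <= d * d <= d]. *)
- have pd : p * d <= p * (1 - a) by rewrite ler_wpM2l.
  have qd : q * d <= q * (1 - b) by rewrite ler_wpM2l.
  by exfalso; nra.
Qed.


Lemma signP {R : realDomainType} (x : R) :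
  exists2 s, s = 1 \/ s = -1 & s * x = `|x|.
Proof.
by case: ger0P => _;
  [exists 1; [left|rewrite mul1r] | exists (-1); [right|rewrite mulN1r]].
Qed.

(* Moving [y] along [(s1, s2)] changes the functional [s1 y1 + s2 y2] but not
   the other extreme functional [s1 y1 - s2 y2] of the dual ball, and the norm
   is the maximum of the two. *)
Lemma ell1_adjust_functional {R : realType} (y : ell1_2 R) (s1 s2 a : R) :
  s1 = 1 \/ s1 = -1 -> s2 = 1 \/ s2 = -1 -> `|y| <= 1 -> `|a| <= 1 ->
  exists y' : ell1_2 R, [/\ `|y'| <= 1, s1 * y'.1 + s2 * y'.2 = a &
    `|y - y'| = `|s1 * y.1 + s2 * y.2 - a|].
Proof.
case: y => y1 y2; rewrite [X in X <= _](_ : _ = `|y1| + `|y2|)//.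
rewrite ler_norml => s1E s2E y12 /andP[a1 a2].
(* Each coordinate takes half of the required change [l], because s1^2 + s2^2 = 2. *)
pose l := a - (s1 * y1 + s2 * y2).
exists (y1 + s1 * l / 2, y2 + s2 * l / 2); split.
- rewrite [X in X <= _](_ : _ = `|y1 + s1 * l / 2| + `|y2 + s2 * l / 2|)//.
  rewrite /l; case: s1E => ->; case: s2E => ->; move: y12;
    by do 4 ![case: ger0P => ?] => *; lra.
- by rewrite /l /=; case: s1E => ->; case: s2E => ->; lra.
- rewrite [LHS](_ : _ =
      `|y1 - (y1 + s1 * l / 2)| + `|y2 - (y2 + s2 * l / 2)|)//.
  rewrite /=; have -> : s1 * y1 + s2 * y2 - a = - l by rewrite /l; ring.
  clearbody l; rewrite !opprD !addNKr !normrN !normrM normfV.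
  have -> : `|s1| = 1 by case: s1E => ->; rewrite ?normrN normr1.
  have -> : `|s2| = 1 by case: s2E => ->; rewrite ?normrN normr1.
  by rewrite normr_nat; lra.
Qed.

(** The signs of [T x] select an extreme functional [f] norming it, and the signs of [x] reduce to
    nonnegative weights. [scalar_BPB] corrects [f] composed with [T], and [ell1_adjust_functional]
    lifts each corrected coefficient to a vector. *)
Lemma ell1_BPB_set {R : realType} (eps d : R) (A : set (ell1_2 R))
    (B : set {linear ell1_2 R -> ell1_2 R}) :
  A `<=` @unit_ball _ _ -> B `<=` @op_unit_ball _ _ _ ->
  0 < d -> d <= 1 -> 2 * eps <= d ^+ 2 -> BPB_set A B eps d.
Proof.
move=> A1 B1 d0 d1 dd; split=> // x T /A1 x1 /B1[_].
rewrite ell1_op_norm ge_max => /andP[T1 T2].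
have NE (y : ell1_2 R) : `|y| = `|y.1| + `|y.2| by [].
have [s1 s1E s1y] := signP (T x).1.
have [s2 s2E s2y] := signP (T x).2.
have [t1 t1E t1x] := signP x.1.
have [t2 t2E t2x] := signP x.2.
pose f (y : ell1_2 R) := s1 * y.1 + s2 * y.2.
have f_le y : `|f y| <= `|y|.
  rewrite NE (le_trans (ler_normD _ _))// !normrM.
  have -> : `|s1| = 1 by case: s1E => ->; rewrite ?normrN normr1.
  have -> : `|s2| = 1 by case: s2E => ->; rewrite ?normrN normr1.
  by rewrite !mul1r.
have fD (a b : R) (y z : ell1_2 R) : f (a *: y + b *: z) = a * f y + b * f z.
  by rewrite /f /= /GRing.scale/=; ring.
have t11 : t1 * t1 = 1 by case: t1E => ->; lra.
have t22 : t2 * t2 = 1 by case: t2E => ->; lra.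
have nt1 : `|t1| = 1 by case: t1E => ->; rewrite ?normrN normr1.
have nt2 : `|t2| = 1 by case: t2E => ->; rewrite ?normrN normr1.
have xE1 : x.1 = t1 * `|x.1| by rewrite -t1x mulrA t11 mul1r.
have xE2 : x.2 = t2 * `|x.2| by rewrite -t2x mulrA t22 mul1r.
rewrite {1}NE -s1y -s2y -/(f (T x)) ell1_linearE fD {1}xE1 {1}xE2.
move=> Tx.
have := @scalar_BPB _ eps d `|x.1| `|x.2|
  (t1 * f (T e1)) (t2 * f (T e2)) d0 d1 dd.
case=> //.
- by rewrite normrM nt1 mul1r (le_trans (f_le _)).
- by rewrite normrM nt2 mul1r (le_trans (f_le _)).
- by rewrite (lt_le_trans Tx)// le_eqVlt; apply/orP; left; apply/eqP; ring.
move=> p [q [a [b [[p0 q0 pq a1 b1] [ab zd ad bd]]]]].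
have [|u [u1 fu Tu]] := ell1_adjust_functional _ _ _ (t1 * a) s1E s2E T1.
  by rewrite normrM nt1 mul1r.
have [|v [v1 fv Tv]] := ell1_adjust_functional _ _ _ (t2 * b) s1E s2E T2.
  by rewrite normrM nt2 mul1r.
have nz : `|(t1 * p, t2 * q) : ell1_2 R| = 1.
  by rewrite NE/= !normrM nt1 nt2 !mul1r !ger0_norm.
have Fz : `|ell1_op u v (t1 * p, t2 * q)| = 1.
  apply/eqP; rewrite eq_le; apply/andP; split.
    rewrite (le_trans (ell1_op_le _ _))//= nz mulr1 ell1_op_e1 ell1_op_e2.
    by rewrite ge_max u1.
  rewrite (le_trans _ (f_le _))// /ell1_op fD/= [f u]fu [f v]fv.
  rewrite (_ : _ + _ = (t1 * t1) * (a * p) + (t2 * t2) * (b * q)); last by ring.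
  by rewrite t11 t22 !mul1r ab normr1.
exists (t1 * p, t2 * q), (ell1_op u v); split=> //.
- split; first exact: ell1_bounded.
  apply/eqP; rewrite eq_le; apply/andP; split.
    by rewrite ell1_op_norm/= ell1_op_e1 ell1_op_e2 ge_max u1.
  by rewrite -Fz ell1_op_norm (le_trans (ell1_op_le _ _))// nz mulr1.
- rewrite NE/= {1}xE1 {1}xE2 -!mulrBr !normrM nt1 nt2 !mul1r.
  exact: zd.
- rewrite ell1_op_norm/= ell1_op_e1 ell1_op_e2 gt_max Tu Tv.
  apply/andP; split.
    by rewrite -[X in `|X|]mul1r -t11 -mulrA mulrBr mulrA t11 mul1r normrM
      nt1 mul1r.
  by rewrite -[X in `|X|]mul1r -t22 -mulrA mulrBr mulrA t22 mul1r normrM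
      nt2 mul1r.
Qed.

(** * Failure of convergence *)

Lemma inf_BPB_set_le {R : realType} (X Y : normedModType R) (A : set X)
    (B : set {linear X -> Y}) (eps d : R) :
  BPB_set A B eps d -> inf (BPB_set A B eps) <= d.
Proof. by apply: ge_inf; exists 0 => ? [/ltW]. Qed.

Lemma rho_to_1_near {R : realType} (a : R) : a < 1 ->
  \forall rho \near rho_to_1 R, a < 2 - 1 / val rho.
Proof.
move=> a1; exists [set r : R | (2 - a)^-1 < r].
  apply: nbhs_left_gt; rewrite invf_lt1; lra.
move=> rho /=; have /andP[r2 _] := valP rho.
have r0 : 0 < val rho by rewrite (lt_le_trans _ r2)// invr_gt0.
rewrite -[ltRHS]invrK ltf_pV2 ?posrE ?invr_gt0//; last lra.
rewrite div1r; lra.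
Qed.

Theorem theorem3p7 (R : realType) (eps : R) (heps : 0 < eps < 2^-1) :
  ~ (Phi (ell1_2 R) (Yspace rho) eps @[rho --> rho_to_1 R]
       --> Phi (ell1_2 R) (ell1_2 R) eps) /\
  ~ (PhiS (ell1_2 R) (Yspace rho) eps @[rho --> rho_to_1 R]
       --> PhiS (ell1_2 R) (ell1_2 R) eps).
Proof.
move: heps => /andP[e0 e2].
have sb (X : normedModType R) : @unit_sphere R X `<=` @unit_ball R X.
  by move=> x; rewrite /unit_sphere /unit_ball/= => ->.
have sbop (X Y : normedModType R) :
    @op_unit_sphere R X Y `<=` @op_unit_ball R X Y.
  by move=> T [T0 T1]; split=> //; rewrite T1.
(* The mean of 1 and [2 * eps] is below 1 because [eps < 1/2], and avoids a square root. *)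
pose d := (1 + 2 * eps) / 2.
have d1 : d < 1 by rewrite /d; lra.
have d0 : 0 < d by rewrite /d; lra.
(* AM-GM for 1 and 2 eps *)
have dd : 2 * eps <= d ^+ 2.
  by rewrite /d; have := sqr_ge0 (1 - 2 * eps); rewrite !expr2; lra.
have nearY : \forall rho \near rho_to_1 R, 1 - 2 * eps < 2 - 1 / val rho.
  by apply: rho_to_1_near; lra.
have contra (Psi : rho_range R -> R) (l : R) : l <= d ->
    (\forall rho \near rho_to_1 R, 1 <= Psi rho) ->
    ~ (Psi rho @[rho --> rho_to_1 R] --> l).
  move=> ld Psi1 Psil.
  have Psi_lt : \forall rho \near rho_to_1 R, Psi rho < 1.
    by apply: cvgr_lt Psil _ _; lra.
  have [rho [rho1]] := filter_ex (filterI Psi_lt Psi1).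
  by rewrite leNgt rho1.
split; apply: contra.
- exact/inf_BPB_set_le/(ell1_BPB_set _ _ _ _ _ _ d0 (ltW d1) dd).
- apply: filterS nearY => rho nr.
  by apply: (Yspace_inf_BPB_set_ge1 _ _ _ _ nr) => //.
- exact/inf_BPB_set_le/(ell1_BPB_set _ _ _ _ (sb _) (sbop _ _) d0 (ltW d1) dd).
- apply: filterS nearY => rho nr.
  exact: (Yspace_inf_BPB_set_ge1 _ _ _ _ nr _ (sb _) _ (sbop _ _)).
Qed.
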